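(* Let $1<p<\infty$ and let $q\in\mathbb{N}$. Let $x=\sum_{n=1}^{\infty}J_nx_n\in X_\omega$ be the canonical exterior decomposition of $x$. Assume that the essential range $\operatorname{essran}(x)$ is finite and satisfies $|\operatorname{essran}(x)|\le q$. Then $\operatorname{supp}_{\mathrm{ext}}(x)$ is finite and $$\bigl|\operatorname{supp}_{\mathrm{ext}}(x)\bigr|\le q-1.$$
   Context: All function spaces are real, $1<p<\infty$ is fixed, and $\mathbb{N}=\{1,2,\dots\}$. For $n\in\mathbb{N}$, $\Omega_n=\{0,1\}^n$ carries the uniform probability measure $\mu_n$ (on its power set), and $H_n=\{f\in L^p(\Omega_n,\mu_n):\int_{\Omega_n}f\,d\mu_n=0\}$. Let $(\Omega,\Sigma,\mu)=\prod_{n=1}^\infty(\Omega_n,\mathcal{P}(\Omega_n),\mu_n)$ be the product probability space, $\pi_n\colon\Omega\to\Omega_n$ the $n$-th coordinate projection, and $J_n\colon L^p(\Omega_n,\mu_n)\to L^p(\Omega,\mu)$, $J_nf=f\circ\pi_n$. Let $X_\omega$ be the closure in $L^p(\Omega)$ of $\operatorname{span}\{J_n(H_n):n\in\mathbb{N}\}$. Every $x\in X_\omega$ has a unique representation $x=\sum_{n=1}^\infty J_nx_n$ with $x_n\in H_n$ and convergence in $L^p(\Omega)$, called its canonical exterior decomposition; the exterior support of $x$ is $\operatorname{supp}_{\mathrm{ext}}(x)=\{n\in\mathbb{N}:x_n\ne0\}$. For a real random variable $f$ on $(\Omega,\mu)$, $\operatorname{essran}(f)$ is the set of all $a\in\mathbb{R}$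 such that $\mu(\{|f-a|<\varepsilon\})>0$ for every $\varepsilon>0$. *)

(* Defs.v *)
From HB Require Import structures.
From mathcomp Require Import all_boot all_order all_algebra finmap.
From mathcomp Require Import all_classical all_reals all_analysis.
From mathcomp Require Import lra.

Set Implicit Arguments.
Unset Strict Implicit.
Unset Printing Implicit Defensive.
Import Order.TTheory GRing.Theory Num.Theory.
Import numFieldNormedType.Exports.

Local Open Scope classical_set_scope.
Local Open Scope ring_scope.

Definition cube (n : nat) : Type := {ffun 'I_n -> bool}.

HB.instance Definition _ n := Finite.on (cube n).
HB.instance Definition _ n := isPointed.Build (cube n) [ffun=> false].
HB.instance Definition _ n := @isMeasurable.Build default_measure_display
  (cube n) discrete_measurable discrete_measurable0
  discrete_measurableC discrete_measurableU.

Lemma card_fset_set n (A : set (cube n)) :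
  #|` fset_set A| = #|[pred w | w \in A]|.
Proof.
rewrite cardE; apply/perm_size/uniq_perm => [//||w]; first exact: enum_uniq.
rewrite mem_enum inE in_fset_set //; exact: (@finite_finset (cube n)).
Qed.

Section cube_unif.
Context (R : realType) (n : nat).

Definition cube_unif : set (cube n) -> \bar R :=
  mscale (2 ^- n)%:nng (@counting (cube n) R).

HB.instance Definition _ := Measure.on cube_unif.

Lemma cube_unifE (A : set (cube n)) :
  cube_unif A = (#|[pred w | w \in A]|%:R / 2 ^+ n)%:E.
Proof.
rewrite /cube_unif /mscale /= /counting asboolT.
  by rewrite -EFinM mulrC card_fset_set.
exact: (@finite_finset (cube n)).
Qed.

Let cube_unifT : cube_unif setT = 1%E.
Proof.
rewrite cube_unifE (eq_card (B := predT)) => [|w]; last first.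
  by rewrite unfold_in /= mem_setT.
by rewrite card_ffun card_bool card_ord natrX divff// expf_neq0.
Qed.

HB.instance Definition _ :=
  Measure_isProbability.Build _ _ _ cube_unif cube_unifT.

End cube_unif.
Arguments cube_unif : clear implicits.

(* Factors are shifted: the index k : nat stands for the integer k + 1 >= 1, *)
(* so the k-th factor of the product is cube k.+1.                           *)
Definition cube_seq : Type := forall k : nat, cube k.+1.

HB.instance Definition _ := Choice.on cube_seq.
HB.instance Definition _ := isPointed.Build cube_seq (fun k => point).

Definition coord (k : nat) (w : cube_seq) : cube k.+1 := w k.

Definition coord_sets : set (set cube_seq) :=
  [set B | exists k (A : set (cube k.+1)), B = coord k @^-1` A].

Definition Omega := g_sigma_algebraType coord_sets.
HB.instance Definition _ := Measurable.on Omega.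

Definition is_product_measure (R : realType) (P : set Omega -> \bar R) : Prop :=
  forall (N : nat) (A : forall k, set (cube k.+1)),
    P [set w : Omega | forall k, (k < N)%N -> A k (coord k w)] =
    (\prod_(k < N) cube_unif R k.+1 (A k))%E.

(* Existence: push Lebesgue measure on [0, 1[ forward along binary digits,   *)
(* cut into consecutive blocks of lengths 1, 2, 3, and so on.                *)
Section product_measure_construction.
Context (R : realType).
Implicit Types (t : R) (k n : nat) (s : seq bool).

(* bit t k is the k-th binary digit of t in [0, 1[ *)
Let bit t k : bool :=
  `[< exists m : nat, m.*2.+1%:R <= t * 2 ^+ k.+1 < m.*2.+2%:R >].

Let pow2_gt0 n : (0 : R) < 2 ^+ n. Proof. by rewrite exprn_gt0. Qed.

Let bitE t n (M : nat) : M%:R <= t * 2 ^+ n < M.+1%:R ->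
  bit t n = (M%:R + 2^-1 <= t * 2 ^+ n).
Proof.
rewrite /bit exprS mulrCA; set y := t * _ => /andP[lo hi].
have natE (m : nat) : m.*2.+1%:R = m%:R * 2 + 1 :> R.
  by rewrite -natr1 -muln2 natrM.
apply/asboolP/idP => [[m]|h].
  rewrite -[in X in _ < X]natr1 natE => /andP[mlo mhi].
  have mM : (m <= M)%N.
    by rewrite -ltnS -(ltr_nat R) -natr1; move: hi; rewrite -natr1; lra.
  have Mm : (M <= m)%N.
    by rewrite -ltnS -(ltr_nat R) -natr1; lra.
  have /eqP mE : m == M by rewrite eqn_leq mM.
  by move: mlo; rewrite mE; lra.
exists M; rewrite -[in X in _ < X]natr1 natE; move: hi; rewrite -natr1; lra.
Qed.

Let bit_cylinder s : exists M : nat,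
  [set t | mkseq (bit t) (size s) = s] `&` [set` `[0%R, 1%R[] =
  [set` `[M%:R / 2 ^+ size s, M.+1%:R / 2 ^+ size s[ ] :> set R.
Proof.
elim/last_ind: s => [|s b [M IH]].
  exists 0%N; rewrite /= expr0 !divr1.
  by apply/seteqP; split => t /=; [case|].
exists (M.*2 + b)%N; rewrite size_rcons.
have -> : [set t | mkseq (bit t) (size s).+1 = rcons s b] =
    [set t | mkseq (bit t) (size s) = s] `&` [set t | bit t (size s) = b].
  apply/seteqP; split => t /=; rewrite mkseqS.
    by move=> /rcons_inj [].
  by move=> [-> ->].
rewrite setIAC IH; set n := size s.
apply/seteqP; split => t /=;
  rewrite !in_itv /= !ler_pdivrMr ?ltr_pdivlMr// exprS mulrCA;
  have := @bitE t n M; set y := t * _;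
  rewrite -(@natr1 _ M) -(@natr1 _ (_ + _)) natrD -muln2 natrM.
  move=> H [yM]; rewrite H// => <-; move: yM => /andP[lo hi].
  by case: (leP (M%:R + 2^-1) y) => /= h; apply/andP; split; lra.
move=> H /andP[lo hi].
have yM : M%:R <= y < M%:R + 1.
  by apply/andP; move: lo hi; case: (b) => /= lo hi; split; lra.
split=> //; rewrite H//; move: lo hi; case: (b) => /= lo hi.
  by apply/idP; lra.
by apply/negbTE; rewrite -ltNge; lra.
Qed.

Let lam : set (measurableTypeR R) -> \bar R :=
  mrestr (@lebesgue_measure R) (measurable_itv `[0%R, 1%R[).

#[local] HB.instance Definition _ := Measure.on lam.

Let lamT : lam setT = 1%E.
Proof.
rewrite /lam /mrestr setTI lebesgue_measure_itv/= lte_fin ltr01.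
by rewrite -EFinB subr0.
Qed.

Let lam_cylinder s : lam [set t | mkseq (bit t) (size s) = s] =
  (2 ^- size s)%:E.
Proof.
rewrite /lam /mrestr; have [M ->] := bit_cylinder s.
rewrite lebesgue_measure_itv/= lte_fin ltr_pM2r ?invr_gt0// ltr_nat leqnn.
by rewrite -EFinB -mulrBl -natr1 addrAC subrr add0r mul1r.
Qed.

Let measurable_bit k b :
  measurable ([set t | bit t k = b] : set (measurableTypeR R)).
Proof.
have mT : measurable ([set t | bit t k] : set (measurableTypeR R)).
  have -> : [set t | bit t k] =
      \bigcup_(m in @setT nat)
        [set` `[m.*2.+1%:R / 2 ^+ k.+1, m.*2.+2%:R / 2 ^+ k.+1[ ] :> set R.
    apply/seteqP; split => t /=.
      move=> /asboolP[m H]; exists m => //=.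
      by rewrite in_itv/= ler_pdivrMr// ltr_pdivlMr.
    move=> [m _] /=; rewrite in_itv/= ler_pdivrMr// ltr_pdivlMr// => H.
    by apply/asboolP; exists m.
  by apply: bigcup_measurable => m _; exact: measurable_itv.
case: b => //.
rewrite (_ : [set t | _] = ~` [set t | bit t k]); first exact: measurableC.
by apply/seteqP; split => t /=; case: bit.
Qed.

Let off k : nat := \sum_(j < k) j.+1.
Let block k t : cube k.+1 := [ffun i : 'I_k.+1 => bit t (off k + i)].
Let digits t : Omega := fun k => block k t.

Let measurable_block k (A : set (cube k.+1)) :
  measurable (block k @^-1` A : set (measurableTypeR R)).
Proof.
have -> : block k @^-1` A = \bigcup_(c in A)
    \big[setI/setT]_(i < k.+1) [set t | bit t (off k + i) = c i].
  rewrite /preimage; apply/seteqP; split => t /=.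
    move=> Ab; exists (block k t) => //.
    by rewrite -bigcap_seq => i _ /=; rewrite ffunE.
  move=> [c Ac]; rewrite -bigcap_seq => H.
  rewrite (_ : block k t = c)//; apply/ffunP => i; rewrite ffunE.
  by apply: H; rewrite /= mem_index_enum.
apply: fin_bigcup_measurable => [|c _].
  exact: (@finite_finset (cube k.+1)).
by apply: bigsetI_measurable => i _; exact: measurable_bit.
Qed.

Let measurable_digits :
  measurable_fun setT (digits : measurableTypeR R -> Omega).
Proof.
apply: (@measurability _ _ _ _ setT digits coord_sets) => //.
move=> _ [_ [k [A ->]] <-]; rewrite setTI.
exact: (@measurable_block k A).
Qed.

Let blockP k t (c : cube k.+1) :
  [seq bit t i | i <- iota (off k) k.+1] = codom c <-> block k t = c.
Proof.
have -> : [seq bit t i | i <- iota (off k) k.+1] = codom (block k t).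
  rewrite -[off k]addn0 iotaDl -val_enum_ord -2!map_comp.
  by rewrite codomE; apply: eq_map => i /=; rewrite ffunE.
split=> [|-> //]; rewrite !codomE => /eq_in_map H.
by apply/ffunP => i; apply: H; rewrite mem_enum.
Qed.

Let block_cylinder (c : forall k, cube k.+1) n :
  lam [set t | forall k, (k < n)%N -> block k t = c k] =
  (\prod_(0 <= k < n) 2 ^- k.+1)%:E.
Proof.
pose word m : seq bool := flatten [seq codom (c k) | k <- iota 0 m].
have wordS m : word m.+1 = word m ++ codom (c m).
  by rewrite /word -[in iota 0 _]addn1 iotaD map_cat flatten_cat /= cats0.
have size_word m : size (word m) = off m.
  elim: m => [|m IH]; first by rewrite /off big_ord0.
  by rewrite wordS size_cat IH /off big_ord_recr /= size_codom card_ord.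
have wordP t m : mkseq (bit t) (size (word m.+1)) = word m.+1 <->
    mkseq (bit t) (size (word m)) = word m /\ block m t = c m.
  rewrite wordS size_cat {1}/mkseq iotaD map_cat -/(mkseq _ _).
  rewrite {2}size_word add0n size_codom card_ord -blockP.
  split=> [/eqP|[-> ->] //].
  by rewrite eqseq_cat ?size_mkseq// => /andP[/eqP-> /eqP->].
rewrite (_ : [set t | _] =
    [set t | mkseq (bit t) (size (word n)) = word n]).
  rewrite lam_cylinder size_word; congr (_%:E).
  elim: n => [|m IH]; first by rewrite /off big_ord0 big_geq// expr0 invr1.
  by rewrite /off big_ord_recr /= exprD invfM IH big_nat_recr.
apply/seteqP; split => t /=; elim: n => [|n IH] //.
  move=> H; apply/wordP; split; last exact: H.
  by apply: IH => k kn; apply: H; exact: ltnW.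
by move=> /wordP[/IH H Hn] k; rewrite ltnS leq_eqVlt => /predU1P[->|/H].
Qed.

Let block_product (A : forall k, set (cube k.+1)) N :
  forall (c : forall k, cube k.+1) K,
  lam [set t | (forall k, (k < N)%N -> A k (block k t)) /\
               (forall k, (N <= k < N + K)%N -> block k t = c k)] =
  (\prod_(0 <= k < N) (#|[pred w | w \in A k]|%:R / 2 ^+ k.+1) *
   \prod_(N <= k < N + K) 2 ^- k.+1)%:E.
Proof.
elim: N => [|N IH] c K.
  rewrite [in RHS]big_geq// mul1r -(block_cylinder c); congr (lam _).
  by apply/seteqP; split => t /= => [[_ H] k kK|H]; [exact: H|split].
pose ev a := [set t | (forall k, (k < N)%N -> A k (block k t)) /\
  (forall k, (N <= k < N + K.+1)%N -> block k t = dfwith c N a k)].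
have -> : [set t | (forall k, (k < N.+1)%N -> A k (block k t)) /\
    (forall k, (N.+1 <= k < N.+1 + K)%N -> block k t = c k)] =
    \bigcup_(a in A N) ev a.
  apply/seteqP; split => t /=.
    move=> [H1 H2]; exists (block N t); first exact: H1.
    split=> [k kN|k]; first by apply: H1; exact: ltnW.
    rewrite leq_eqVlt => /andP[/predU1P[<- _|Nk kN]]; first by rewrite dfwithin.
    by rewrite dfwithout ?(ltn_eqF Nk)//; apply: H2; rewrite Nk addSnnS.
  move=> [a Aa [H1 H2]]; have HN : block N t = a.
    by rewrite H2 ?dfwithin// leqnn addnS ltnS leq_addr.
  split=> [k|k /andP[Nk kN]].
    by rewrite ltnS leq_eqVlt => /predU1P[->|/H1//]; rewrite HN.
  by rewrite H2 ?dfwithout ?(ltn_eqF Nk)// ltnW//= -addSnnS.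
have mev a : measurable (ev a : set (measurableTypeR R)).
  rewrite (_ : ev a = (\bigcap_(k < N) (block k @^-1` A k)) `&`
    \bigcap_(k in [set k | (N <= k < N + K.+1)%N])
      (block k @^-1` [set dfwith c N a k])).
    by apply: measurableI; apply: bigcap_measurableType => k _;
      exact: measurable_block.
  by apply/seteqP; split.
have finA : finite_set (A N) by exact: (@finite_finset (cube N.+1)).
rewrite measure_fin_bigcup//; last first.
  move=> a b _ _ [t [[_ Ha] [_ Hb]]].
  have NN : (N <= N < N + K.+1)%N by rewrite leqnn addnS ltnS leq_addr.
  by have := Ha N NN; rewrite (Hb N NN) !dfwithin.
rewrite (eq_fsbigr (fun=> (\prod_(0 <= k < N)
    (#|[pred w | w \in A k]|%:R / 2 ^+ k.+1) *
   \prod_(N <= k < N + K.+1) 2 ^- k.+1)%:E)); last by move=> a _; exact: IH.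
rewrite fsbig_finite//= sumEFin big_const_seq count_predT iter_addr addr0.
congr (_%:E); rewrite big_nat_recr//= addnS addSn.
rewrite [in LHS](@big_ltn _ _ _ N) ?ltnS ?leq_addr//.
rewrite card_fset_set -[LHS]mulr_natl [LHS]mulrC -!mulrA; congr (_ * _).
by rewrite mulrA mulrC.
Qed.

#[local] HB.instance Definition _ := Measure_isProbability.Build _ _ _ lam lamT.

#[local] HB.instance Definition _ :=
  isMeasurableFun.Build _ _ _ _ (digits : measurableTypeR R -> Omega)
    measurable_digits.

Lemma product_measure_exists :
  exists P : probability Omega R, is_product_measure P.
Proof.
exists (distribution lam (digits : {mfun measurableTypeR R >-> Omega})).
move=> N A; rewrite /distribution /pushforward /=.
transitivity (lam [set t | (forall k, (k < N)%N -> A k (block k t)) /\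
               (forall k, (N <= k < N + 0)%N -> block k t = point)]).
  congr (lam _); apply/seteqP; split => t /= => [H|[]//]; split=> // k.
  by rewrite addn0 => /andP[/leq_ltn_trans H' /H']; rewrite ltnn.
rewrite block_product addn0 [X in _ * X]big_geq// mulr1 big_mkord -prodEFin.
by apply: eq_bigr => k _; rewrite cube_unifE.
Qed.

End product_measure_construction.

Definition prod_measure (R : realType) : probability Omega R :=
  projT1 (cid (product_measure_exists R)).

Lemma prod_measureP (R : realType) : is_product_measure (prod_measure R).
Proof. exact: projT2 (cid (product_measure_exists R)). Qed.

Section exterior.
Context (R : realType).
Local Notation mu := (prod_measure R).
Implicit Types (p : R) (k : nat) (x : Omega -> R).

(* Elements of L^p(Omega) are handled through representatives: membership in *)
(* X_omega, convergence and essran are invariant under mu-a.e. equality. All *)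
(* points of cube n have positive mass, so functions on cube n need no       *)
(* quotient, and x_n <> 0 in L^p(cube n) is plain inequality of functions.   *)
Definition Hn (p : R) (n : nat) : set (cube n -> R) :=
  [set f | f \in Lfun (cube_unif R n) p%:E /\
           \int[cube_unif R n]_w f w = 0].
Arguments Hn : clear implicits.

Definition J (k : nat) (f : cube k.+1 -> R) : Omega -> R := f \o coord k.

Definition lin_span (T : Type) (A : set (T -> R)) : set (T -> R) :=
  [set y | exists (m : nat) (c : 'I_m -> R) (g : 'I_m -> T -> R),
     (forall i, A (g i)) /\ y = (fun w => \sum_(i < m) c i * g i w)].

Definition Lp_dist (p : R) (x y : Omega -> R) : \bar R :=
  ('N[mu]_p%:E[EFin \o (x \- y)%R])%E.

Definition Lp_closure (p : R) (A : set (Omega -> R)) : set (Omega -> R) :=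
  [set x | x \in Lfun mu p%:E /\
     forall e : R, 0 < e -> exists2 y, A y & (Lp_dist p x y < e%:E)%E].

Definition X_omega (p : R) : set (Omega -> R) :=
  Lp_closure p (lin_span (\bigcup_k (J (k := k) @` Hn p k.+1))).

Definition canonical_exterior_decomposition (p : R) (x : Omega -> R)
    (x_ : forall k, cube k.+1 -> R) : Prop :=
  (forall k, Hn p k.+1 (x_ k)) /\
  Lp_dist p x (fun w => \sum_(k < m) J (x_ k) w) @[m --> \oo] --> 0%E.

Definition supp_ext (x_ : forall k, cube k.+1 -> R) : set nat :=
  [set k.+1 | k in [set k | x_ k <> cst 0]].

Definition essran (x : Omega -> R) : set R :=
  [set a | forall e : R, 0 < e -> (0 < mu [set w | `|x w - a| < e]%R)%E].

End exterior.

(* Main.v *)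
Require Import Defs.
From HB Require Import structures.
From mathcomp Require Import all_boot all_order all_algebra finmap.
From mathcomp Require Import fingroup perm.
From mathcomp Require Import all_classical all_reals all_analysis.
From mathcomp Require Import measurable_realfun.
From mathcomp Require Import lra.

Set Implicit Arguments.
Unset Strict Implicit.
Unset Printing Implicit Defensive.
Import Order.TTheory GRing.Theory Num.Theory.
Import numFieldNormedType.Exports.

Local Open Scope classical_set_scope.
Local Open Scope ring_scope.
Import Defs.

(** If x_k is nonzero then, having mean zero, it is not constant: there are
    points a_k and b_k of the k-th cube with x_k(a_k) < x_k(b_k). Changing the
    k-th coordinate of w from a_k to b_k raises x(w) by the positive amount
    x_k(b_k) - x_k(a_k), whatever the other coordinates are. So from one
    essential value v of x on the cylinder where the first N coordinates are
    a_0, ..., a_(N-1), changing these coordinates one after the other produces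
    the increasing essential values
      v + sum over k < j of (x_k(b_k) - x_k(a_k)),   0 <= j <= N,
    which jump strictly at every k < N in the exterior support. With n points
    of the support below N this yields n + 1 values ([essran_chain],
    [card_steps]), whence n + 1 <= q.

    The coordinate changes are realised by transpositions of points of each
    cube. They preserve each uniform measure, hence the product measure, by
    uniqueness of the latter ([prod_measure_permute]). As x is only an L^p
    limit, the identity x(s w) = x(w) + d is never used pointwise: it holds
    exactly for the partial sums of the decomposition, and these are close to
    x in probability both at w and at s w ([essran_translate]). *)

(** * Measurable functions: deviation bounds and essential values *)

(** Markov's inequality for the p-th power, in the form that turns smallness
    of the L^p norm into smallness in measure. *)
Lemma Lp_chebyshev d (T : measurableType d) (R : realType)
    (mu : {measure set T -> \bar R}) (p e c : R) (f : T -> R) :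
  0 < p -> 0 < e -> 0 < c -> measurable_fun setT f ->
  ('N[mu]_p%:E[EFin \o f] < (e * c `^ p^-1)%:E)%E ->
  (mu [set w | e <= `|f w|]%R <= c%:E)%E.
Proof.
move=> p0 e0 c0 mf fN.
have := @le_integral_comp_abse _ _ _ mu _ measurableT (EFin \o f) e
  (fun r => r `^ p)%E.
have poweR_homo : {in `[0%E, +oo[%classic &,
    {homo (fun r : \bar R => r `^ p)%E : x y / (x <= y)%E}}.
  move=> a b; rewrite !inE /= !in_itv /= !andbT => a0 b0 ab.
  by apply: (gt0_ler_poweR (ltW p0)); rewrite // in_itv /= leey andbT.
move=> /(_ (measurable_poweR _)) /(_ (fun r _ => poweR_ge0 r p)).
move=> /(_ poweR_homo).
move=> /(_ (proj2 (measurable_EFinP _ _) mf) e0).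
rewrite setTI -poweR_Lnorm ?gt_eqF//.
have -> : [set x | (e%:E <= `|(EFin \o f) x|)%E] = [set w | e <= `|f w|]%R.
  by apply/seteqP; split => w /=; rewrite lee_fin.
have NN : ('N[mu]_p%:E[EFin \o f] `^ p <= (e `^ p * c)%:E)%E.
  apply: le_trans (_ : ((e * c `^ p^-1)%:E `^ p <= _)%E).
    apply: (gt0_ler_poweR (ltW p0)); last exact: ltW.
      by rewrite in_itv /= leey andbT Lnorm_ge0.
    by rewrite in_itv /= leey andbT lee_fin mulr_ge0 ?powR_ge0 // ltW.
  rewrite poweR_EFin lee_fin powRM ?powR_ge0 ?(ltW e0)//.
  rewrite -powRrM mulVf ?gt_eqF//.
  by rewrite powRr1 // ltW.
move=> /le_trans/(_ NN); rewrite poweR_EFin EFinM lee_pmul2l//.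
by rewrite lte_fin powR_gt0.
Qed.

Lemma measurable_near_value d (T : measurableType d) (R : realType)
    (f : T -> R) (v e : R) :
  measurable_fun setT f -> measurable [set w | `|f w - v| < e].
Proof.
move=> mf; rewrite -[X in measurable X]setTI.
have -> : [set w | `|f w - v| < e] =
    (fun w => `|f w - v|) @^-1` [set` `]-oo, e[ ].
  by apply/seteqP; split => w /=; rewrite in_itv.
apply: (measurableT_comp (@normr_measurable R setT)) => //.
exact: measurable_funB.
Qed.

(** Lindelof: were every real v surrounded by an interval that f meets on A in
    a null set only, countably many such intervals, with rational centres and
    radii 1/(n+1), would cover the line, and A would be null. *)
Lemma ess_value_exists d (T : measurableType d) (R : realType)
    (mu : {measure set T -> \bar R}) (A : set T) (f : T -> R) :
  measurable A -> measurable_fun setT f -> (0 < mu A)%E ->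
  exists v, forall e : R, 0 < e ->
    (0 < mu (A `&` [set w | `|f w - v| < e]%R))%E.
Proof.
move=> mA mf muA; apply: contrapT => /forallNP H.
have mball v e : measurable (A `&` [set w | `|f w - v| < e]%R).
  by apply: measurableI => //; exact: measurable_near_value.
pose B (i : rat * nat) := A `&` [set w | `|f w - ratr i.1| < i.2.+1%:R^-1]%R.
pose N n := if choice.unpickle n is Some i then
  if mu (B i) == 0%E then B i else set0 else set0.
have N0 : mu.-negligible (\bigcup_n N n).
  apply: negligible_bigcup => n; rewrite /N.
  case: choice.unpickle => [i|]; last exact: negligible_set0.
  case: eqP => [Bi0|_]; last exact: negligible_set0.
  by exists (B i); split => //; exact: mball.
suff AN : A `<=` \bigcup_n N n.
  have /negligibleP : mu.-negligible A by exact: negligibleS N0.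
  by move=> /(_ mA) A0; move: muA; rewrite A0 ltxx.
move=> w Aw; have /existsNP[e /not_implyP[e0 /negP]] := H (f w).
rewrite -leNgt measure_le0 => /eqP mu0.
have e20 : 0 < e / 2 by rewrite divr_gt0.
(* If r is rational and within 1/(n+1) of f w, the ball around r of that      *)
(* radius lies in the null e-ball around f w.                                 *)
have [n _ /(_ n (leqnn n)) /= ne] := near_infty_natSinv_lt (PosNum e20).
have [r rP] : exists r : rat, ratr r \in `](f w), (f w + n.+1%:R^-1)[%R.
  by apply: rat_in_itvoo; rewrite ltrDl invr_gt0 ltr0n.
move: rP; rewrite in_itv /= => /andP[r1 r2].
have Brn : mu (B (r, n)) = 0%E.
  apply/eqP; rewrite -measure_le0 -mu0; apply: le_measure; rewrite ?inE//.
    exact: mball.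
  move=> z [Az] /= zr; split => //=.
  apply: le_lt_trans (ler_distD (ratr r) _ _) _.
  rewrite (gtr0_norm (x := ratr r - f w)) ?subr_gt0// (splitr e).
  apply: ltrD; first exact: lt_trans zr ne.
  by rewrite ltrBlDl; apply: lt_trans r2 _; rewrite ltrD2l.
exists (choice.pickle (r, n)); first exact: I.
rewrite /N choice.pickleK Brn eqxx; split; first exact: Aw.
rewrite /= distrC gtr0_norm ?subr_gt0// ltrBlDl.
exact: r2.
Qed.

(** * Invariance of the product measure under coordinatewise permutations *)

Definition rect (N : nat) (A : forall k, set (cube k.+1)) : set Omega :=
  [set w | forall k, (k < N)%N -> A k (coord k w)].

Definition rects : set (set Omega) := [set B | exists N A, B = rect N A].

Lemma measurable_coord k (A : set (cube k.+1)) :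
  measurable (coord k @^-1` A : set Omega).
Proof. by apply: sub_sigma_algebra; exists k, A. Qed.

Lemma measurable_rect N A : measurable (rect N A).
Proof.
have -> : rect N A = \bigcap_(k < N) (coord k @^-1` A k) by [].
by apply: bigcap_measurableType => k _; exact: measurable_coord.
Qed.

Lemma setI_closed_rects : setI_closed rects.
Proof.
move=> _ _ [N [A ->]] [M [B ->]]; exists (maxn N M).
exists (fun k => [set c | ((k < N)%N -> A k c) /\ ((k < M)%N -> B k c)]).
apply/seteqP; split=> w /= => [[Aw Bw] k _|H].
  by split; [exact: Aw|exact: Bw].
split=> k kN; have := H k; rewrite leq_max kN ?orbT => /(_ isT) [HA HB].
  exact: HA.
exact: HB.
Qed.

Lemma measurable_Omega_rects : @measurable _ Omega = <<s rects >>.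
Proof.
apply/seteqP; split; last first.
  apply: smallest_sub; first exact: sigma_algebra_measurable.
  by move=> _ [N [A ->]]; exact: measurable_rect.
apply: smallest_sub; first exact: smallest_sigma_algebra.
move=> _ [k [A ->]]; apply: sub_sigma_algebra.
exists k.+1, (dfwith (fun=> setT) k A); apply/seteqP; split=> w /=.
  move=> Aw j _; have [<-|jk] := eqVneq k j; first by rewrite dfwithin.
  by rewrite dfwithout.
by move=> /(_ k (ltnSn k)); rewrite dfwithin.
Qed.

(** Two product measures agree on the finite rectangles, a generating class
    closed under intersection. *)
Lemma product_measure_unique (R : realType)
    (P Q : {measure set Omega -> \bar R}) :
  is_product_measure P -> is_product_measure Q ->
  forall B, measurable B -> P B = Q B.
Proof.
move=> Pprod Qprod; pose T (k : nat) := rect 0 (fun=> setT).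
apply: (measure_unique rects T measurable_Omega_rects setI_closed_rects).
- by move=> k; exists 0%N, (fun=> setT).
- by apply/seteqP; split => // w _; exists 0%N.
- by move=> _ [N [A ->]]; rewrite Pprod Qprod.
- by move=> k; rewrite Pprod big_ord0 ltry.
Qed.

Definition permute (s : forall k, {perm cube k.+1}) (w : Omega) : Omega :=
  fun k => s k (w k).

Lemma measurable_permute s : measurable_fun setT (permute s).
Proof.
apply: (@measurability _ _ _ _ setT (permute s) coord_sets) => //.
move=> _ [_ [k [A ->]] <-]; rewrite setTI.
exact: (measurable_coord (s k @^-1` A)).
Qed.

HB.instance Definition _ s :=
  isMeasurableFun.Build _ _ _ _ (permute s) (measurable_permute s).

Lemma cube_unif_perm (R : realType) n (s : {perm cube n}) (A : set (cube n)) :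
  cube_unif R n (s @^-1` A) = cube_unif R n A.
Proof.
rewrite !cube_unifE; congr (_%:R / _)%:E.
rewrite (eq_card (B := preim s [pred w | w \in A])); last first.
  by move=> w; rewrite !inE.
rewrite card_preim; last exact: perm_inj.
by apply: eq_card => w; rewrite !inE -{1}[w](permKV s) codom_f.
Qed.

(** The image measure is again a product measure: the preimage of a rectangle
    is the rectangle with permuted sides, and a permutation of a cube preserves
    cardinality. *)
Lemma prod_measure_permute (R : realType) s (B : set Omega) :
  measurable B -> prod_measure R (permute s @^-1` B) = prod_measure R B.
Proof.
move=> mB.
apply: (@product_measure_unique R
  (pushforward (prod_measure R) (permute s))) => //; last exact: prod_measureP.
move=> N A; apply: etrans (_ : _ = (\prod_(k < N) _)%E).
  exact: (@prod_measureP R N (fun k => s k @^-1` A k)).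
by apply: eq_bigr => k _; exact: cube_unif_perm.
Qed.

(** * Essential values of exterior sums *)

Section exterior_sums.
Context (R : realType) (p : R) (x : Omega -> R)
  (x_ : forall k : nat, cube k.+1 -> R).
Arguments x_ : clear implicits.
Hypotheses (p0 : 0 < p) (mx : measurable_fun setT x).
Hypothesis xE :
  Lp_dist p x (fun w => \sum_(k < m) J (x_ k) w) @[m --> \oo] --> 0%E.
Local Notation mu := (prod_measure R).

Let partial_sum m (w : Omega) : R := \sum_(k < m) J (x_ k) w.

Let measurable_partial_sum m : measurable_fun setT (partial_sum m).
Proof.
apply: measurable_sum => k _ B _; rewrite setTI.
exact: (measurable_coord (x_ k @^-1` B)).
Qed.

Let measurable_gap m e : measurable [set w | e <= `|x w - partial_sum m w|]%R.
Proof.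
rewrite (_ : [set w | _] =
    ~` [set w | `|(x \- partial_sum m) w - 0| < e]%R); last first.
  by apply/seteqP; split => w /=; rewrite subr0 leNgt => /negP.
by apply/measurableC/measurable_near_value/measurable_funB.
Qed.

Let partial_sum_cvg_in_measure (e c : R) : 0 < e -> 0 < c ->
  \forall m \near \oo, (mu [set w | e <= `|x w - partial_sum m w|]%R <= c%:E)%E.
Proof.
move=> e0 c0.
have ec : 0 < e * c `^ p^-1 by rewrite mulr_gt0 ?powR_gt0.
have : \forall m \near \oo,
    (Lp_dist p x (partial_sum m) < (e * c `^ p^-1)%:E)%E.
  have /fine_cvgP[fin /cvgrPdist_lt/(_ _ ec) lim] := xE.
  apply: filterS2 fin lim => m fin /=.
  rewrite sub0r normrN -lte_fin => /(le_lt_trans _); apply.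
  by rewrite -[leLHS]fineK// lee_fin ler_norm.
apply: filterS => m.
apply: (Lp_chebyshev (f := x \- partial_sum m)) => //.
exact: measurable_funB.
Qed.

(** On the part of A where x is close to v and a far partial sum is close to x
    both at w and at its permuted image, x at the image is close to v + d. The
    two exceptional sets have arbitrarily small measure, by invariance for the
    second one, so this part is not null, and invariance carries its image into
    the set of points where x is close to v + d. *)
Lemma essran_translate s (A : set Omega) (v d : R) :
  measurable A ->
  (forall e : R, 0 < e -> (0 < mu (A `&` [set w | `|x w - v| < e]%R))%E) ->
  (\forall m \near \oo, forall w, A w ->
     \sum_(k < m) J (x_ k) (permute s w) = \sum_(k < m) J (x_ k) w + d) ->
  essran x (v + d).
Proof.
move=> mA vA shift e e0.
have e30 : 0 < e / 3 by rewrite divr_gt0.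
set B := A `&` [set w | `|x w - v| < e / 3]%R.
have mB : measurable B.
  by apply: measurableI => //; exact: measurable_near_value.
have B0 : (0 < mu B)%E by exact: vA.
pose c := fine (mu B).
have cE : mu B = c%:E by rewrite fineK// fin_num_measure.
have c0 : 0 < c by rewrite -lte_fin -cE.
have c30 : 0 < c / 3 by rewrite divr_gt0.
have [m [shiftm gapm]] : exists m,
    (forall w, A w -> partial_sum m (permute s w) = partial_sum m w + d) /\
    (mu [set w | e / 3 <= `|x w - partial_sum m w|]%R <= (c / 3)%:E)%E.
  have [m] := filter_ex (filterI shift (partial_sum_cvg_in_measure e30 c30)).
  by exists m.
set D := [set w | e / 3 <= _] in gapm.
pose C := [set w | `|x w - (v + d)| < e].
have mC : measurable C by exact: measurable_near_value.
have mD : measurable D by exact: measurable_gap.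
have mperm Y : measurable Y -> measurable (permute s @^-1` Y).
  by move=> mY; rewrite -[X in measurable X]setTI; exact: measurable_funPT.
(* Three errors of e/3: of x at v, and of the partial sum at w and at s w. *)
have sub : B `<=` D `|` permute s @^-1` D `|` permute s @^-1` C.
  move=> w [Aw /= xv].
  have [Dw|Dw] := lerP (e / 3) `|x w - partial_sum m w|; first by left; left.
  have [Ds|Ds] := lerP (e / 3) `|x (permute s w) - partial_sum m (permute s w)|.
    by left; right.
  right; rewrite /C /=; move: xv Dw Ds; rewrite shiftm//.
  rewrite !ltr_norml => /andP[? ?] /andP[? ?] /andP[? ?].
  by apply/andP; split; lra.
have gapms : (mu (permute s @^-1` D) <= (c / 3)%:E)%E.
  by rewrite prod_measure_permute.
have : (mu B <= (c / 3 + c / 3)%:E + mu C)%E.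
  rewrite -(prod_measure_permute R s mC).
  apply: le_trans (le_measure mu _ _ sub) _; rewrite ?inE//.
    by apply: measurableU; [apply: measurableU|]; rewrite //; exact: mperm.
  apply: le_trans (measureU2 _ _ _) _; [|exact: mperm|].
    by apply: measurableU => //; exact: mperm.
  apply: leeD; last exact: lexx.
  apply: le_trans (measureU2 _ _ _) _; [by []|exact: mperm|].
  by rewrite EFinD; exact: leeD.
rewrite cE => cC; change (0 < mu C)%E.
rewrite lt0e measure_ge0 andbT; apply/eqP => C0; move: cC.
by rewrite C0 adde0 lee_fin; lra.
Qed.

(** The j-th value is the translate of v by the transpositions of a_k and b_k
    for k < j, which turn a_k into b_k on the cylinder of the a_k. *)
Lemma essran_chain (a b : forall k, cube k.+1) N :
  exists v, forall j, (j <= N)%N ->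
    essran x (v + \sum_(k < j) (x_ k (b k) - x_ k (a k))).
Proof.
pose A := rect N (fun k => [set a k]).
have mA : measurable A by exact: measurable_rect.
have A0 : (0 < mu A)%E.
  rewrite /A prod_measureP.
  under eq_bigr do rewrite cube_unifE.
  rewrite prodEFin lte_fin; apply: prodr_gt0 => k _.
  rewrite divr_gt0 ?exprn_gt0// ltr0n; apply/card_gt0P; exists (a k).
  by rewrite !inE.
have [v vA] := ess_value_exists mA mx A0.
exists v => j jN.
pose s k : {perm cube k.+1} := if (k < j)%N then tperm (a k) (b k) else 1%g.
apply: (essran_translate (s := s) mA vA).
near=> m => w Aw.
have Nm : (N <= m)%N by near: m; exact: nbhs_infty_ge.
rewrite (big_ord_widen m (fun k => x_ k (b k) - x_ k (a k)) (leq_trans jN Nm)).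
rewrite [X in _ + X]big_mkcond -big_split /=.
apply: eq_bigr => k _; rewrite /J /permute /coord /s /=.
case: ifPn => kj; last by rewrite perm1 addr0.
have -> : w k = a k by apply: Aw; exact: leq_trans kj jN.
by rewrite tpermL addrC subrK.
Unshelve. all: by end_near.
Qed.

End exterior_sums.

(** * Counting *)

Lemma mean_zero_increase (R : realType) p n (f : cube n -> R) :
  Hn p f -> f <> cst 0 -> exists ab : cube n * cube n, f ab.1 < f ab.2.
Proof.
move=> [_ f0] fn0; apply: contrapT => /forallNP H; apply: fn0.
have fE : f = cst (f point).
  apply/funext => w; apply/eqP; rewrite eq_le !leNgt.
  apply/andP; split; apply/negP; first exact: (H (point, w)).
  exact: (H (w, point)).
have muT : cube_unif R n setT = 1%E := probability_setT _.
rewrite fE -[in RHS]f0 {2}fE; congr cst.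
apply/esym; apply: etrans (Rintegral_cst (cube_unif R n) measurableT _) _.
exact: etrans (congr1 (fun z => _ * fine z) muT) (mulr1 _).
Qed.

(** A nondecreasing sequence is injective on its strict jumps together with any
    one later index, here N; this last index gives the strict inequality. *)
Lemma card_steps (R : realType) (d : nat -> R) (K : {fset nat}) (E : set R)
    (N : nat) :
  {homo d : i j / (i <= j)%N >-> i <= j} ->
  (forall k, k \in K -> (k < N)%N /\ d k < d k.+1) ->
  (forall j, (j <= N)%N -> E (d j)) -> finite_set E ->
  (#|` K| < #|` fset_set E|)%N.
Proof.
move=> dmono dK dE finE.
have NK : N \notin K by apply/negP => /dK[]; rewrite ltnn.
have lt_d i j : i \in K -> (i < j)%N -> d i < d j.
  by move=> /dK[_ di] ij; apply: lt_le_trans di _; exact: dmono.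
have dinj : {in N |` K &, injective d}%fset.
  have cmp i j : i \in (N |` K)%fset -> j \in (N |` K)%fset ->
      (i < j)%N -> d i < d j.
    rewrite !in_fset1U => /predU1P[->|iK]; last by move=> _; exact: lt_d.
    move=> /predU1P[->|/dK[jN _]]; first by rewrite ltnn.
    by move=> /(ltn_trans jN); rewrite ltnn.
  move=> i j iK jK dij; case: (ltngtP i j) => // ij.
    by have := cmp _ _ iK jK ij; rewrite dij ltxx.
  by have := cmp _ _ jK iK ij; rewrite dij ltxx.
have -> : #|` K|.+1 = #|` (d @` (N |` K))%fset|.
  by rewrite card_in_imfset// cardfsU1 NK.
apply: fsubset_leq_card; apply/fsubsetP => _ /imfsetP[j /= jK ->].
rewrite in_fset_set// inE; apply: dE.
by move: jK; rewrite in_fset1U => /predU1P[->|/dK[/ltnW]].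
Qed.

Theorem proposition2p2 (R : realType) (p : R) (hp : 1 < p)
    (q : nat) (hq : (0 < q)%N)
    (x : Omega -> R) (hx : X_omega p x)
    (x_ : forall k : nat, cube k.+1 -> R)
    (hdec : canonical_exterior_decomposition p x x_)
    (hfin : finite_set (essran x))
    (hcard : (#|` fset_set (essran x)| <= q)%N) :
  finite_set (supp_ext x_) /\
  (#|` fset_set (supp_ext x_)| <= q - 1)%N.
Proof.
have p0 : 0 < p by rewrite (lt_trans _ hp).
have [Hx_ xE] := hdec.
have mx : measurable_fun setT x.
  by have [/sub_Lfun_mfun + _] := hx; rewrite inE.
pose K := [set k | x_ k <> cst 0].
(* Off the support both points are the same, so that the chain is constant. *)
have exab k : exists ab : cube k.+1 * cube k.+1,
    x_ k ab.1 <= x_ k ab.2 /\ (K k -> x_ k ab.1 < x_ k ab.2).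
  have [Kk|nKk] := pselect (K k); last by exists (point, point).
  by have [ab lt_ab] := mean_zero_increase (Hx_ k) Kk; exists ab; rewrite ltW.
pose ab k := projT1 (cid (exab k)).
have abP k : x_ k (ab k).1 <= x_ k (ab k).2 /\
    (K k -> x_ k (ab k).1 < x_ k (ab k).2) := projT2 (cid (exab k)).
have bound (B : {fset nat}) : [set` B] `<=` K -> (#|` B| < q)%N.
  move=> BK; pose N := (\max_(k <- B) k).+1.
  have [v vE] := essran_chain p0 mx xE (fun k => (ab k).1)
    (fun k => (ab k).2) N.
  apply: leq_trans hcard; apply: card_steps vE hfin => [|k kB].
    apply/nondecreasing_seqP => k.
    by rewrite big_ord_recr /= addrA lerDl subr_ge0; have [] := abP k.
  split; first by rewrite ltnS; exact: leq_bigmax_seq.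
  rewrite big_ord_recr /= addrA ltrDl subr_gt0.
  by have [_] := abP k; apply; exact: BK.
have finK : finite_set K.
  apply: contrapT => /(infinite_set_fset q)[B /bound Bq].
  by rewrite leqNgt Bq.
split; first exact: finite_image.
rewrite fset_set_image//; apply: leq_trans (leq_imfset_card _ _ _) _.
rewrite -ltnS subn1 prednK//; apply: bound => k /=.
by rewrite in_fset_set// inE.
Qed.
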